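(* There exists a set $A\subseteq\mathbb{Z}^d$ which is additively $\mathrm{IP}^*$ but such that $A\setminus\{0\}$ is not syndetic in the semigroup $(\mathbb{Z}^d_{\neq0},\circledast)$ for any proper multiplication $\circledast$ on $\mathbb{Z}^d$.
   Context: A proper multiplication on $\mathbb{Z}^d$ is a binary operation $\circledast:\mathbb{Z}^d\times\mathbb{Z}^d\to\mathbb{Z}^d$ making $(\mathbb{Z}^d,+)$ an associative (not necessarily commutative or unital) ring without zero divisors; $\mathbb{Z}^d_{\neq0}=\mathbb{Z}^d\setminus\{0\}$. A subset of $\mathbb{Z}^d$ is additively $\mathrm{IP}$ if it contains $\{\sum_{i\in I}x_i: I\subseteq\mathbb{N}\text{ finite non-empty}\}$ for some sequence $(x_n)_{n\in\mathbb{N}}$ in $\mathbb{Z}^d$; it is additively $\mathrm{IP}^*$ if it meets every additively $\mathrm{IP}$ subset of $\mathbb{Z}^d$. In a semigroup $(S,\cdot)$, $B\subseteq S$ is syndetic if there are $s_1,\dots,s_k\in S$ with $S=s_1^{-1}\cdot B\cup\dots\cup s_k^{-1}\cdot B$, where $s^{-1}\cdot B=\{t: s\cdot t\in B\}$. *)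

(* Defs.v *)
From HB Require Import structures.
From mathcomp Require Import all_boot all_order all_algebra.
From mathcomp Require Import finmap.
From mathcomp Require Import boolp classical_sets.

Set Implicit Arguments.
Unset Strict Implicit.
Unset Printing Implicit Defensive.

Import GRing.Theory.
Local Open Scope classical_set_scope.
Local Open Scope ring_scope.

Definition finite_sums (V : zmodType) (x : nat -> V) : set V :=
  [set y | exists2 I : {fset nat}, I != fset0 & y = \sum_(i <- I) x i].

Definition additively_IP (V : zmodType) (A : set V) : Prop :=
  exists x : nat -> V, finite_sums x `<=` A.

Definition additively_IPstar (V : zmodType) (A : set V) : Prop :=
  forall B : set V, additively_IP B -> A `&` B !=set0.

Definition inv_translate (S : semigroupType) (s : S) (B : set S) : set S :=
  [set t | B (s * t)%g].

Definition syndetic (S : semigroupType) (B : set S) : Prop :=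
  exists r : seq S, [set: S] = \bigcup_(s in [set` r]) inv_translate s B.

(* The library's rings are unital, so the non-unital ring axioms are listed. *)
Record proper_mult (d : nat) := ProperMult {
  pmul :> 'rV[int]_d -> 'rV[int]_d -> 'rV[int]_d;
  pmulA : associative pmul;
  pmulDl : left_distributive pmul +%R;
  pmulDr : right_distributive pmul +%R;
  pmul_eq0 : forall x y, pmul x y = 0 -> x = 0 \/ y = 0
}.

(* The parameter m is a phantom on which the semigroup structure is keyed. *)
Definition nonzero (d : nat) (m : proper_mult d) : Type :=
  {x : 'rV[int]_d | x != 0}.

HB.instance Definition _ (d : nat) (m : proper_mult d) :=
  SubChoice.copy (nonzero m) {x : 'rV[int]_d | x != 0}.

Lemma nonzero_mul_subproof (d : nat) (m : proper_mult d) (x y : nonzero m) :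
  m (val x) (val y) != 0.
Proof.
apply/eqP => /pmul_eq0 [] /eqP; first by rewrite (negbTE (valP x)).
by rewrite (negbTE (valP y)).
Qed.

Definition nonzero_mul (d : nat) (m : proper_mult d) (x y : nonzero m) :
    nonzero m :=
  exist _ (m (val x) (val y)) (nonzero_mul_subproof x y).

Lemma nonzero_mulA (d : nat) (m : proper_mult d) :
  associative (@nonzero_mul d m).
Proof. by move=> x y z; apply: val_inj; rewrite /= pmulA. Qed.

HB.instance Definition _ (d : nat) (m : proper_mult d) :=
  isSemigroup.Build (nonzero m) (@nonzero_mulA d m).

(* Main.v *)
Require Import Defs.
From mathcomp Require Import all_boot all_order all_algebra.
From mathcomp Require Import boolp classical_sets.
From mathcomp Require Import finmap zify.

Import GRing.Theory.
Local Open Scope classical_set_scope.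
Local Open Scope ring_scope.

(** Let [C] be the union over [n] of the dilates by [n`!] of the punctured boxes
    [{g <> 0 : |g_i| <= n}], and let [A] be its complement.

    Any two distinct points of [C], the higher of level [n], differ by at least
    [(n-1)!] in some coordinate, since [n`! - k * k`! >= (n-1)!] for [k < n].
    So if [C] contained the finite sums of [x], then every finite sum [s] of
    [x 1, x 2, ...] would be bounded, because [s] and [s + x 0] are both in [C];
    by pigeonhole two partial sums would coincide, and a block of consecutive
    terms would sum to [0], which is not in [C]. Hence [A] is IP*.

    For any multiplication [m], any finite set [r] and any [e <> 0], the
    products [m s (n`! e) = n`! (m s e)], [s] in [r], all lie in [C] once [n]
    bounds the coordinates of the [m s e]. Hence [A] is not syndetic. *)

Definition dilated_boxes (d : nat) : set 'rV[int]_d :=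
  [set c | exists n (g : 'rV[int]_d),
     [/\ g != 0, forall i, (`|g 0%R i| <= n)%N & c = g *+ n`!]].

Lemma mulmxn_entry_abs (d : nat) (v : 'rV[int]_d) (n : nat) i :
  `|(v *+ n) 0%R i|%N = (`|v 0%R i| * n)%N.
Proof. by rewrite mulmxnE -mulr_natr abszM natz. Qed.

Lemma rV_neq0_entry (d : nat) (v : 'rV[int]_d) :
  v != 0 -> exists i, (0 < `|v 0%R i|)%N.
Proof.
by move=> /matrix0Pn[i [j]]; rewrite ord1 => vj; exists j; rewrite absz_gt0.
Qed.

Lemma mulmxn_neq0 (d : nat) (v : 'rV[int]_d) (n : nat) :
  v != 0 -> (0 < n)%N -> v *+ n != 0.
Proof.
move=> /rV_neq0_entry[i vi] n0; apply/eqP => /rowP /(_ i) /(congr1 absz).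
by rewrite mulmxn_entry_abs mxE; lia.
Qed.

Lemma dilated_boxes_neq0 (d : nat) (c : 'rV[int]_d) :
  dilated_boxes d c -> c != 0.
Proof. by move=> [n [g [g0 _ ->]]]; rewrite mulmxn_neq0 ?fact_gt0. Qed.

(** At a coordinate where [g] is nonzero, the first term is at least (n+1)! in absolute value and
    the second at most n * n!, which leaves at least n! >= n. *)
Lemma dilated_boxes_gap_levels (d : nat) (g h : 'rV[int]_d) (n k : nat) :
    (k <= n)%N -> g != 0 -> (forall i, (`|h 0%R i| <= k)%N) ->
  exists i, (n <= `|((g *+ n.+1`! - h *+ k`!) 0 i)%R|)%N.
Proof.
move=> kn /rV_neq0_entry[i gi] hk; exists i.
have gE := mulmxn_entry_abs _ g n.+1`! i.
have hE := mulmxn_entry_abs _ h k`! i.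
have hle : (`|h 0%R i| * k`! <= n * n`!)%N.
  by rewrite leq_mul ?leq_fact// (leq_trans (hk i)).
have gge : (n.+1`! <= `|g 0%R i| * n.+1`!)%N by rewrite leq_pmull.
have nfact := fact_geq n; have factE := factS n.
rewrite mxE [X in (_ + X)%R]mxE.
move: gE hE hle gge nfact factE.
move: ((g *+ n.+1`!) 0 i) ((h *+ k`!) 0 i) (`|g 0%R i| * n.+1`!)%N => x y z.
move: (`|h 0%R i| * k`!)%N (n.+1`!) (n`!) => w u v.
nia.
Qed.

(** It suffices to bound the level [n] of [c] by [B]. Points on distinct levels are far apart by the
    previous lemma; on a common level, a nonzero entry of [D] is a multiple of n!, hence at least n
    in absolute value. *)
Lemma dilated_boxes_gap (d : nat) (c D : 'rV[int]_d) (B : nat) :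
    dilated_boxes d c -> dilated_boxes d (c + D) -> D != 0 ->
    (forall i, (`|D 0%R i| < B)%N) ->
  forall i, (`|c 0%R i| <= B * B`!)%N.
Proof.
move=> [n [g [g0 gn ->]]] [k [h [h0 hk cD]]] D0 DB i.
suff nB : (n <= B)%N.
  by rewrite mulmxn_entry_abs leq_mul ?leq_fact// (leq_trans (gn i)).
have DE : D = h *+ k`! - g *+ n`! by rewrite -cD [_ + D]addrC addrK.
case: (ltngtP n k) => [nk|kn|nk].
- case: k => // k in hk cD DE nk *.
  have [j] := dilated_boxes_gap_levels _ h g k n nk h0 gn.
  rewrite -DE => /leq_ltn_trans/(_ (DB j)) kB.
  exact: ltnW (leq_trans nk kB).
- case: n => // n in gn cD DE kn *.
  have [j] := dilated_boxes_gap_levels _ g h n k kn g0 hk.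
  have -> : g *+ n.+1`! - h *+ k`! = - D by rewrite DE opprB.
  by rewrite mxE abszN => /leq_ltn_trans/(_ (DB j)).
- have [j Dj] := rV_neq0_entry _ _ D0.
  move: Dj (DB j); rewrite DE -nk -mulrnBl mulmxn_entry_abs.
  rewrite muln_gt0 => /andP[Dj _] DjB; apply: leq_trans (fact_geq n) _.
  exact: ltnW (leq_ltn_trans (leq_pmull _ Dj) DjB).
Qed.

Lemma bounded_seq_not_injective (d B : nat) (s : nat -> 'rV[int]_d) :
    (forall j i, (`|s j 0%R i| <= B)%N) ->
  exists j k, (j < k)%N /\ s j = s k.
Proof.
move=> sB.
(* Adding [B] moves all entries into the interval from 0 to 2B, where neither the absolute value nor
   [inord] loses information. *)
pose f j : 'rV['I_(B + B).+1]_d := \row_i inord `|s j 0%R i + B%:Z|.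
have f_inj j k : f j = f k -> s j = s k.
  move=> /rowP fjk; apply/rowP => i.
  have := congr1 val (fjk i); have := sB j i; have := sB k i.
  by rewrite !mxE /= => jB kB; rewrite !inordK; lia.
pose T : finType := 'rV['I_(B + B).+1]_d.
have : ~~ injectiveb (fun j : 'I_(#|T|.+1) => f j).
  apply/injectiveP => /leq_card; rewrite card_ord.
  by rewrite ltnn.
move=> /injectivePn[j [k jk /f_inj sjk]].
case: (ltngtP j k) => [lt|lt|eq].
- by exists j, k.
- by exists k, j.
- by rewrite (val_inj eq) eqxx in jk.
Qed.

Lemma finite_sums_uniq (V : zmodType) (x : nat -> V) (r : seq nat) :
  uniq r -> r != [::] -> finite_sums x (\sum_(i <- r) x i).
Proof.
move=> r_uniq r0; exists [fset i in r]%fset.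
  case: r r0 {r_uniq} => // a r _; apply/fset0Pn; exists a.
  by rewrite !inE eqxx.
apply: perm_big; apply: uniq_perm => // [|i]; first exact: fset_uniq.
by rewrite !inE.
Qed.

Lemma dilated_boxes_not_IP (d : nat) : ~ additively_IP (dilated_boxes d).
Proof.
move=> [x xC].
have xsum r : uniq r -> r != [::] -> dilated_boxes d (\sum_(i <- r) x i).
  by move=> ur r0; apply/xC/finite_sums_uniq.
have x00 : x 0%N != 0.
  by apply: dilated_boxes_neq0; have := xsum [:: 0%N]; rewrite big_seq1; apply.
pose B := (\max_i `|x 0%N 0%R i|).+1.
have xB i : (`|x 0%N 0%R i| < B)%N by rewrite ltnS (leq_bigmax i).
(* Index 0 is left out so that adding [x 0] yields another finite sum. *)
pose s n := \sum_(1 <= i < n.+2) x i.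
have sB n i : (`|s n 0%R i| <= B * B`!)%N.
  apply: dilated_boxes_gap x00 xB i; first by apply: xsum; rewrite ?iota_uniq.
  rewrite addrC /s -(@big_ltn _ _ _ 0 n.+2)//.
  by apply: xsum; rewrite ?iota_uniq.
have [j [k [jk sjk]]] := bounded_seq_not_injective _ _ _ sB.
(* These are the terms of [s k] missing from [s j], so they add up to 0. *)
have /dilated_boxes_neq0/eqP[] : dilated_boxes d (\sum_(j.+2 <= i < k.+2) x i).
  apply: xsum; rewrite ?iota_uniq// -size_eq0 size_iota; lia.
move: sjk; rewrite /s (@big_cat_nat _ _ _ j.+2 1 k.+2)//=; last by lia.
by rewrite -[LHS]addr0 => /addrI.
Qed.

Lemma pmulrnr (d : nat) (m : proper_mult d) x y n : m x (y *+ n) = m x y *+ n.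
Proof.
elim: n => [|n IHn]; last by rewrite !mulrS pmulDr IHn.
by rewrite !mulr0n; apply: (addrI (m x 0)); rewrite -pmulDr !addr0.
Qed.

Theorem theorem5p12 (d : nat) (d_gt0 : (0 < d)%N) :
  exists A : set 'rV[int]_d,
    additively_IPstar A /\
    forall m : proper_mult d,
      ~ syndetic [set u : nonzero m | (A `\ 0) (val u)].
Proof.
exists (~` dilated_boxes d); split=> [B [x xB] | m [r rT]].
  apply: contrapT => AB0; apply: (@dilated_boxes_not_IP d); exists x => y xy.
  by apply: contrapT => Cy; apply: AB0; exists y; split=> //; apply: xB.
pose e : 'rV[int]_d := const_mx 1.
have e0 : e != 0.
  by apply/eqP => /rowP /(_ (Ordinal d_gt0)); rewrite !mxE.
(* One [n] serves all of [r]: the bound involves only [e], and the factor n! is applied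
   afterwards. *)
pose n := (\max_(s <- r) \max_i `|m (val s) e 0%R i|)%N.
have t0 : e *+ n`! != 0. by rewrite mulmxn_neq0 ?fact_gt0.
pose t : nonzero m := exist _ (e *+ n`!) t0.
have [s sr [/= nC _]] :
    (\bigcup_(s in [set` r])
       inv_translate s [set u : nonzero m | (~` dilated_boxes d `\ 0) (val u)]) t.
  by rewrite -rT.
apply: nC; rewrite pmulrnr; exists n, (m (val s) e); split=> // [|i].
  by apply/eqP => /pmul_eq0 [] /eqP; rewrite ?(negbTE e0)// (negbTE (valP s)).
apply: leq_trans (leq_bigmax (F := fun j => `|m (val s) e 0%R j|%N) i) _.
exact: (@leq_bigmax_seq _ r xpredT (fun s => \max_j `|m (val s) e 0%R j|)%N).
Qed.
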